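(* Let $G=\mathbb{Z}/3\mathbb{Z}\star\mathbb{Z}/3\mathbb{Z}$, with $a$ and $b$ generators of the two cyclic factors, and let $\Sigma=\{a,a^2,b,b^2\}$. Let $p\in(0,1/2)$ and let $\mu$ be the probability measure with $\mu(a)=\mu(a^2)=p$ and $\mu(b)=\mu(b^2)=1/2-p$. Then the harmonic measure of the random walk $(G,\mu)$ is the Markovian multiplicative measure associated with the vector $r$ given by $$r(a)=r(a^2)=\frac{1+2p}{6},\qquad r(b)=r(b^2)=\frac{1-p}{3},$$ and the drift of the walk (with respect to $\Sigma$) is $\gamma=2p(1-2p)$.
   Context: For a free product $G=G_1\star G_2$ of two nontrivial finite groups, put $\Sigma_i=G_i\setminus\{1\}$ and $\Sigma=\Sigma_1\sqcup\Sigma_2$; for $u\in\Sigma$, $\Sigma_u$ denotes the $\Sigma_i$ containing $u$. Every $g\in G$ has a unique normal form $g=u_1\cdots u_n$ with $u_j\in\Sigma$ and $u_{j+1}\notin\Sigma_{u_j}$; its length with respect to $\Sigma$ is $|g|=n$. Random walk $(G,\mu)$: $X_0=1$, $X_{n+1}=X_nx_n$ with $(x_n)$ i.i.d. of law $\mu$. The drift is $\gamma=\lim_n |X_n|/n$ (a.s.). When the walk is transient, the normal form of $X_n$ converges a.s., letter by letter, to an infinite normal form word $X_\infty\in\Sigma^{\mathbb{N}}$ (an infinite word with $u_{j+1}\notin\Sigma_{u_j}$ for all $j$); the harmonic measure $\mu^\infty$ is the law of $X_\infty$. For a vector $r\in(0,1)^\Sigma$ with $\sum_{u\in\Sigma}r(u)=1$,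 write $r(E)=\sum_{u\in E}r(u)$ for $E\subset\Sigma$ and $q(u)=r(u)/r(\Sigma\setminus\Sigma_u)$. The Markovian multiplicative measure associated with $r$ is the probability measure $\nu$ on infinite normal form words such that $\nu(u_1\cdots u_n\Sigma^{\mathbb{N}})=q(u_1)\cdots q(u_{n-1})\,r(u_n)$ for every finite normal form word $u_1\cdots u_n$, where $u_1\cdots u_n\Sigma^{\mathbb{N}}$ is the set of infinite words with prefix $u_1\cdots u_n$. *)

(* Defs.v *)
From HB Require Import structures.
From mathcomp Require Import all_boot all_order all_fingroup all_algebra all_solvable.
From mathcomp Require Import finmap.
From mathcomp Require Import all_classical all_reals all_analysis.

Set Implicit Arguments.
Unset Strict Implicit.
Unset Printing Implicit Defensive.

Import Order.TTheory GRing.Theory Num.Theory.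
Import numFieldNormedType.Exports.

(* A letter is an element of the disjoint union of the two factors. The       *)
(* identities [inl 1] and [inr 1] are allowed in the type [letter] and are    *)
(* excluded by membership in [Sigma].                                         *)
Definition letter (G1 G2 : finGroupType) : Type := (G1 + G2)%type.

HB.instance Definition _ (G1 G2 : finGroupType) := Finite.on (letter G1 G2).
HB.instance Definition _ (G1 G2 : finGroupType) :=
  isPointed.Build (letter G1 G2) (inl 1%g).

Definition nontrivial (G1 G2 : finGroupType) (u : letter G1 G2) : bool :=
  match u with inl x => x != 1%g | inr y => y != 1%g end.

Definition same_factor (G1 G2 : finGroupType) (u v : letter G1 G2) : bool :=
  match u, v with inl _, inl _ | inr _, inr _ => true | _, _ => false end.

Definition Sigma (G1 G2 : finGroupType) : {set letter G1 G2} :=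
  [set u | nontrivial u]%SET.

Definition Sigma_of (G1 G2 : finGroupType) (u : letter G1 G2) :
    {set letter G1 G2} :=
  [set v in Sigma G1 G2 | same_factor u v]%SET.

Definition normal_form (G1 G2 : finGroupType) (s : seq (letter G1 G2)) : bool :=
  all (mem (Sigma G1 G2)) s && sorted (fun u v => v \notin Sigma_of u) s.

(* The free product is realised as the set of normal forms; [fpmul] is        *)
(* concatenation followed by reduction.                                       *)
Record freeprod (G1 G2 : finGroupType) := FreeProd {
  fpword :> seq (letter G1 G2);
  _ : normal_form fpword }.

HB.instance Definition _ (G1 G2 : finGroupType) :=
  [isSub for @fpword G1 G2].
HB.instance Definition _ (G1 G2 : finGroupType) :=
  [Countable of freeprod G1 G2 by <:].

Definition fplength (G1 G2 : finGroupType) (g : freeprod G1 G2) : nat :=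
  size (fpword g).

Section GroupLaw.
Variables G1 G2 : finGroupType.
Local Notation letter := (letter G1 G2).
Local Notation freeprod := (freeprod G1 G2).
Implicit Types (u v c : letter) (s t w : seq letter).

(* Only meaningful when [u] and [v] lie in the same factor. *)
Definition lmul u v : letter :=
  match u, v with
  | inl x, inl y => inl (x * y)%g
  | inr x, inr y => inr (x * y)%g
  | _, _ => u
  end.

Definition linv u : letter :=
  match u with inl x => inl x^-1%g | inr y => inr y^-1%g end.

Definition lcons u s : seq letter := if nontrivial u then u :: s else s.

(* Normal form of [u * s], for [s] in normal form. *)
Definition wcons u s : seq letter :=
  if s is v :: s' then
    if same_factor u v then lcons (lmul u v) s' else lcons u s
  else lcons u s.

Definition wmul s t : seq letter := foldr wcons t s.

Definition winv s : seq letter := rev (map linv s).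

Lemma normal_form_cons u s : normal_form (u :: s) =
  [&& nontrivial u, normal_form s &
      if s is v :: _ then ~~ same_factor u v else true].
Proof.
rewrite /normal_form /= inE; case: s => [|v s] /=; first by rewrite !andbT.
rewrite !inE; case: (nontrivial u) => //=; case: (nontrivial v) => //=.
by case: (all _ _) (path _ _ _) (same_factor u v) => [] [] [].
Qed.

Lemma lcons_nf u s : normal_form s ->
  (if s is v :: _ then ~~ same_factor u v else true) -> normal_form (lcons u s).
Proof.
by rewrite /lcons => nfs us; case: ifP => // ntu; rewrite normal_form_cons ntu nfs.
Qed.

Lemma wcons_nf u s : normal_form s -> normal_form (wcons u s).
Proof.
case: s => [|v s] nfs /=; first exact: lcons_nf.
case: ifP => uv; last by apply: lcons_nf => //; rewrite uv.
move: nfs; rewrite normal_form_cons => /and3P[_ nfs vs].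
by apply: lcons_nf => //; case: u v s uv vs {nfs} => [x|x] [y|y] [|[z|z] s].
Qed.

Lemma wmul_nf s t : normal_form t -> normal_form (wmul s t).
Proof. by move=> nft; elim: s => //= u s; exact: wcons_nf. Qed.

Lemma winv_nf s : normal_form s -> normal_form (winv s).
Proof.
rewrite /normal_form /winv all_rev all_map rev_sorted sorted_map.
move=> /andP[sS nfs]; apply/andP; split.
  apply: sub_all sS => -[x|x]; by rewrite !inE /= eq_invg1.
move: sS nfs; case: s => //= u s /andP[uS sS].
elim: s u uS sS => //= v s IHs u uS /andP[vS sS] /andP[uv /(IHs _ vS sS) ->].
rewrite andbT; move: vS uv; rewrite !inE.
by case: u v {IHs uS} => [x|x] [y|y] /= ->; rewrite ?andbF.
Qed.

Lemma wcons_triv u s : normal_form s -> ~~ nontrivial u -> wcons u s = s.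
Proof.
move=> nfs ntu; rewrite /wcons /lcons (negPf ntu); case: s nfs => // v s.
rewrite normal_form_cons => /andP[ntv _]; case: ifP => // uv.
case: u v ntu ntv uv => [x|x] [y|y] //=;
  by rewrite negbK => /eqP -> y1 _; rewrite mul1g y1.
Qed.

Lemma wcons_nt u s : normal_form (u :: s) -> wcons u s = u :: s.
Proof.
rewrite normal_form_cons => /and3P[ntu _ us].
rewrite /wcons /lcons ntu; case: s us => // v s /negPf -> //.
Qed.

Lemma wconsM u v s : normal_form s -> same_factor u v ->
  wcons u (wcons v s) = wcons (lmul u v) s.
Proof.
case: s => [|c s].
  case: u v => [x|x] [y|y] //= _ _; rewrite /lcons /=;
  by case: (eqVneq y) => [->|_] /=; rewrite ?mulg1.
rewrite normal_form_cons => /and3P[ntc nfs cs].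
case: u v c ntc cs => [x|x] [y|y] [z|z] //= ntc cs _; rewrite /lcons /=.
- case: (eqVneq (y * z)%g) => [yz1|_] /=; last by rewrite mulgA.
  rewrite -mulgA yz1 mulg1 /wcons /lcons /=.
  by case: s cs {nfs} => [|[t|t] s].
- by case: (eqVneq y) => [->|_] /=; rewrite ?mulg1.
- by case: (eqVneq y) => [->|_] /=; rewrite ?mulg1.
- case: (eqVneq (y * z)%g) => [yz1|_] /=; last by rewrite mulgA.
  rewrite -mulgA yz1 mulg1 /wcons /lcons /=.
  by case: s cs {nfs} => [|[t|t] s].
Qed.

Lemma wmul_cons u s t : normal_form s -> normal_form t ->
  wmul (wcons u s) t = wcons u (wmul s t).
Proof.
move=> nfs nft; have lconsE c w : wmul (lcons c w) t = wcons c (wmul w t).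
  rewrite /lcons; case: ifP => //= /negbT ntc.
  by rewrite wcons_triv //; exact: wmul_nf.
case: s nfs => [|v s] nfs //=; case: ifP => uv; rewrite lconsE //.
by rewrite wconsM //; exact: wmul_nf.
Qed.

Lemma wmulA s t w : normal_form s -> normal_form t -> normal_form w ->
  wmul s (wmul t w) = wmul (wmul s t) w.
Proof.
move=> + nft nfw; elim: s => //= u s IHs; rewrite normal_form_cons.
move=> /and3P[_ nfs _]; rewrite wmul_cons ?IHs //; exact: wmul_nf.
Qed.

Lemma wmuls0 s : normal_form s -> wmul s [::] = s.
Proof.
elim: s => //= u s IHs nfus; rewrite IHs ?wcons_nt //.
by move: nfus; rewrite normal_form_cons => /and3P[].
Qed.

Lemma wmulVs s : wmul (winv s) s = [::].
Proof.
elim: s => // u s IHs; rewrite /winv /= rev_cons /wmul foldr_rcons.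
rewrite (_ : wcons _ _ = s) //.
by case: u => x; rewrite /= /lcons /= mulVg eqxx.
Qed.

Lemma winvK : involutive winv.
Proof.
move=> s; rewrite /winv map_rev revK -map_comp map_id_in // => -[x|x] _ /=;
by rewrite invgK.
Qed.

Definition fpmul (g h : freeprod) : freeprod :=
  FreeProd (wmul_nf g (valP h)).
Definition fpone : freeprod := @FreeProd G1 G2 [::] isT.
Definition fpinv (g : freeprod) : freeprod := FreeProd (winv_nf (valP g)).

Let fpmulA : associative fpmul.
Proof.
by move=> g h k; apply: val_inj; apply: wmulA; exact: valP.
Qed.

Let fpmul1g : left_id fpone fpmul.
Proof. by move=> g; exact: val_inj. Qed.

Let fpmulg1 : right_id fpone fpmul.
Proof. by move=> g; apply: val_inj; apply: wmuls0; exact: valP. Qed.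

Let fpmulVg : left_inverse fpone fpinv fpmul.
Proof. by move=> g; apply: val_inj; exact: wmulVs. Qed.

Let fpmulgV : right_inverse fpone fpinv fpmul.
Proof.
by move=> g; apply: val_inj; rewrite /= -[X in wmul X](winvK (fpword g)) wmulVs.
Qed.

HB.instance Definition _ := isGroup.Build (freeprod)
  fpmulA fpmul1g fpmulg1 fpmulVg fpmulgV.

End GroupLaw.

Definition fp_letter (G1 G2 : finGroupType) (u : letter G1 G2) :
    freeprod G1 G2 :=
  FreeProd (wcons_nf u (isT : normal_form [::])).

Section UniversalProperty.
Local Open Scope group_scope.
Variables G1 G2 : finGroupType.
Local Notation letter := (letter G1 G2).
Local Notation freeprod := (freeprod G1 G2).

Lemma fp_letterM (u v : letter) :
  same_factor u v -> fp_letter u * fp_letter v = fp_letter (lmul u v).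
Proof.
move=> uv; apply: val_inj.
rewrite -[RHS]/(wcons (lmul u v) [::]) -wconsM //.
by rewrite -[wcons v _ in RHS]/(wmul [::] (wcons v [::])) -wmul_cons ?wcons_nf.
Qed.

Lemma fpword_prod (g : freeprod) : g = \prod_(u <- fpword g) fp_letter u.
Proof.
case: g => /= s; elim: s => [|u s IHs] nfs.
  by rewrite big_nil; apply: val_inj.
have := nfs; rewrite big_cons normal_form_cons => /and3P[_ nfs' _].
rewrite -(IHs nfs'); apply: val_inj => /=.
by rewrite -/(wcons u [::]) wmul_cons //= wcons_nt.
Qed.

Lemma freeprod_universal (H : groupType) (f1 : G1 -> H) (f2 : G2 -> H) :
  {morph f1 : x y / x * y} -> {morph f2 : x y / x * y} ->
  exists! f : freeprod -> H, [/\ {morph f : x y / x * y},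
    forall x, f (fp_letter (inl x)) = f1 x &
    forall y, f (fp_letter (inr y)) = f2 y].
Proof.
move=> f1M f2M.
have f11 : f1 1 = 1 by apply: (@mulgI _ (f1 1)); rewrite -f1M !mulg1.
have f21 : f2 1 = 1 by apply: (@mulgI _ (f2 1)); rewrite -f2M !mulg1.
pose e (u : letter) := match u with inl x => f1 x | inr y => f2 y end.
pose F (s : seq letter) := \prod_(u <- s) e u.
have Flcons u s : F (lcons u s) = e u * F s.
  rewrite /F /lcons; case: ifP => [_|]; first by rewrite big_cons.
  by case: u => x /negbFE/eqP -> /=; rewrite ?f11 ?f21 mul1g.
have Fwcons u s : F (wcons u s) = e u * F s.
  case: s => [|v s] //=; case: ifP => // uv; rewrite Flcons /F big_cons mulgA.
  by case: u v uv => [x|x] [y|y] //= _; rewrite ?f1M ?f2M.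
have FM s t : F (wmul s t) = F s * F t.
  by elim: s => [|u s IHs] /=; rewrite ?Fwcons ?IHs /F ?big_nil ?mul1g // big_cons mulgA.
have Fl u : F (fp_letter u) = e u by rewrite Fwcons /F big_nil mulg1.
exists (fun g => F (fpword g)); split.
  by split=> [g h|x|y]; [exact: FM|rewrite Fl|rewrite Fl].
move=> f [fM fl fr]; apply/funext => g.
have fe : f 1 = 1 by apply: (@mulgI _ (f 1)); rewrite -fM !mulg1.
rewrite [in RHS](fpword_prod g) (big_morph f fM fe) /F.
by apply: eq_bigr => -[x|y] _ /=; rewrite ?fl ?fr.
Qed.

End UniversalProperty.

HB.instance Definition _ (G1 G2 : finGroupType) :=
  isPointed.Build (freeprod G1 G2) 1%g.
HB.instance Definition _ (G1 G2 : finGroupType) :=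
  @isMeasurable.Build default_measure_display (freeprod G1 G2)
    discrete_measurable discrete_measurable0
    discrete_measurableC discrete_measurableU.

Local Open Scope classical_set_scope.
Local Open Scope ring_scope.

Definition cylinder (G1 G2 : finGroupType) (s : seq (letter G1 G2)) :
    set (nat -> letter G1 G2) :=
  [set xi | mkseq xi (size s) = s].

Definition cylinders (G1 G2 : finGroupType) : set (set (nat -> letter G1 G2)) :=
  range (@cylinder G1 G2).

(* Arbitrary sequences of letters; membership of the letters in [Sigma] and   *)
(* the alternation of factors are imposed by [inf_normal_form].               *)
Definition infword (G1 G2 : finGroupType) : Type :=
  g_sigma_algebraType (@cylinders G1 G2).

HB.instance Definition _ (G1 G2 : finGroupType) :=
  Measurable.on (infword G1 G2).

Definition inf_normal_form (G1 G2 : finGroupType) : set (infword G1 G2) :=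
  [set xi | (forall j, xi j \in Sigma G1 G2) /\
            (forall j, xi j.+1 \notin Sigma_of (xi j))].

(* [onth] is [None] past the end of a word, so the j-th letter of [g n] must   *)
(* exist for all large n.                                                     *)
Definition letterwise_cvg (G1 G2 : finGroupType)
    (g : nat -> freeprod G1 G2) (xi : infword G1 G2) : Prop :=
  forall j, \forall n \near \oo, onth (fpword (g n)) j = Some (xi j).

Definition mutually_independent (d d' : measure_display)
    (T : measurableType d) (E : measurableType d') (R : realType)
    (P : probability T R) (x : nat -> {mfun T >-> E}) : Prop :=
  forall (J : {fset nat}) (A : nat -> set E),
    (forall j, measurable (A j)) ->
    P (\bigcap_(j in [set` J]) (x j @^-1` A j)) =
    (\prod_(j <- J) P (x j @^-1` A j))%E.

Definition iid (d d' : measure_display)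
    (T : measurableType d) (E : measurableType d') (R : realType)
    (P : probability T R) (mu : probability E R)
    (x : nat -> {mfun T >-> E}) : Prop :=
  mutually_independent P x /\
  forall n (A : set E), measurable A -> distribution P (x n) A = mu A.

Fixpoint walk (T : Type) (G : groupType) (x : nat -> T -> G) (n : nat) (w : T)
    : G :=
  if n is n'.+1 then (walk x n' w * x n' w)%g else 1%g.

Definition is_drift (d : measure_display) (T : measurableType d) (R : realType)
    (P : probability T R) (G1 G2 : finGroupType)
    (x : nat -> {mfun T >-> freeprod G1 G2}) (gamma : R) : Prop :=
  {ae P, forall w,
    (fun n => (fplength (walk x n w))%:R / n%:R : R) @ \oo --> gamma}.

(* [nu] is the law of a random infinite normal form word which is almost      *)
(* surely the letter-by-letter limit of the walk with increments [x].         *)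
Definition is_harmonic_measure (d : measure_display) (T : measurableType d)
    (R : realType) (P : probability T R) (G1 G2 : finGroupType)
    (x : nat -> {mfun T >-> freeprod G1 G2})
    (nu : probability (infword G1 G2) R) : Prop :=
  exists Xoo : {mfun T >-> infword G1 G2},
    [/\ {ae P, forall w, inf_normal_form (Xoo w)},
        {ae P, forall w, letterwise_cvg (fun n => walk x n w) (Xoo w)} &
        forall A, measurable A -> distribution P Xoo A = nu A].

Definition qweight (R : realType) (G1 G2 : finGroupType)
    (r : letter G1 G2 -> R) (u : letter G1 G2) : R :=
  r u / \sum_(v in Sigma G1 G2 :\: Sigma_of u) r v.

Definition is_markovian_multiplicative (R : realType) (G1 G2 : finGroupType)
    (r : letter G1 G2 -> R) (nu : probability (infword G1 G2) R) : Prop :=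
  [/\ forall u, u \in Sigma G1 G2 -> 0 < r u < 1,
      \sum_(u in Sigma G1 G2) r u = 1,
      nu (@inf_normal_form G1 G2) = 1%E &
      forall (s : seq (letter G1 G2)) (u : letter G1 G2),
        normal_form (rcons s u) ->
        nu (cylinder (rcons s u)) = ((\prod_(v <- s) qweight r v) * r u)%:E].

(* Main.v *)
(** The identities behind the proof are explicit. If q(u) denotes the
    probability of ever visiting the letter u, then the probability that the
    walk started at g converges to an infinite word with a given prefix t is an
    explicit function f_t of g, which one checks to be harmonic. Hence
    E f_t(X_n) = f_t(1) for all n, while f_t(X_n) converges to the indicator of
    "X_oo starts with t" whenever X_n converges letterwise, so dominated
    convergence gives the harmonic measure of the cylinder of t.

    For the drift, with Q the transition operator of the walk, the Poisson
    equation Q phi = phi + gamma has an explicit solution phi at bounded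
    distance from the length, so that phi(X_n) - phi(1) - n gamma is a
    martingale with bounded increments. Its fourth moment is O(n^2), so the
    series of the fourth moments of its ratio to n converges, and phi(X_n) / n
    tends to gamma almost surely. As gamma > 0 the length tends to infinity, and
    since a step only changes the end of the normal form, letterwise convergence
    follows. *)

Require Import Defs.
From HB Require Import structures.
From mathcomp Require Import all_boot all_order all_fingroup all_algebra all_solvable.
From mathcomp Require Import finmap.
From mathcomp Require Import all_classical all_reals all_analysis.
From mathcomp Require Import measurable_realfun ring lra.

Set Implicit Arguments.
Unset Strict Implicit.
Unset Printing Implicit Defensive.

Import Order.TTheory GRing.Theory Num.Theory.
Import numFieldNormedType.Exports.

Local Open Scope classical_set_scope.
Local Open Scope ring_scope.

(** * Right multiplication by a letter *)

Section Words.
Variables G1 G2 : finGroupType.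
Implicit Types (u v w : letter G1 G2) (s t : seq (letter G1 G2)).

Definition in_left u : bool := if u is inl _ then true else false.

Lemma same_factorE u v : same_factor u v = (in_left u == in_left v).
Proof. by case: u v => [?|?] [?|?]. Qed.

Lemma fpword_fp_letter u : nontrivial u -> fpword (fp_letter u) = [:: u].
Proof. by move=> ntu; rewrite /= /lcons ntu. Qed.

Lemma fp_letter_inj u v : nontrivial u -> nontrivial v ->
  fp_letter u = fp_letter v -> u = v.
Proof.
by move=> ntu ntv /(congr1 (@fpword _ _)); rewrite !fpword_fp_letter // => -[].
Qed.

Lemma fpwordM_letter (g : freeprod G1 G2) u : nontrivial u ->
  fpword (g * fp_letter u)%g = wmul g [:: u].
Proof. by move=> ntu; rewrite -fpword_fp_letter. Qed.

Lemma wmul1E v u : wmul [:: v] [:: u] =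
  if same_factor v u then lcons (lmul v u) [::] else lcons v [:: u].
Proof. by []. Qed.

(** A letter on the right can only meet the last letter, so a word of at least two letters keeps its
    first one. The inductions that peel off first letters rest on this. *)
Lemma wmul_letter_cons v w s u : normal_form (v :: w :: s) -> nontrivial u ->
  wmul (v :: w :: s) [:: u] = v :: wmul (w :: s) [:: u].
Proof.
move=> + ntu; elim: s v w => [|y s IHs] v w nf; last first.
  have := nf; rewrite normal_form_cons => /and3P[ntv nf' vw].
  by rewrite -[LHS]/(wcons v (wmul (w :: y :: s) [:: u])) IHs //= (negPf vw)
    /lcons ntv.
have := nf; rewrite normal_form_cons => /and3P[ntv nf' vw].
rewrite -[LHS]/(wcons v (wmul [:: w] [:: u])) wmul1E.
have ntw : nontrivial w by move: nf'; rewrite normal_form_cons => /andP[].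
case: ifP => wu; last by rewrite /lcons ntw /= (negPf vw) /lcons ntv.
rewrite [lcons (lmul w u) _]/lcons; case: ifP => _ /=; last by rewrite /lcons ntv.
suff -> : same_factor v (lmul w u) = false by rewrite /lcons ntv.
by apply/negbTE; move: vw; case: v w {nf nf' wu ntv ntw} => [?|?] [?|?] //;
  case: u {ntu}.
Qed.

Lemma size_wmul_letter s u : normal_form s -> nontrivial u ->
  (size (wmul s [:: u]) <= (size s).+1)%N /\
  (size s <= (size (wmul s [:: u])).+1)%N.
Proof.
move=> + ntu; elim: s => [//|v [|w s] IHs] nf.
  rewrite wmul1E /lcons; do 3 case: ifP => //.
have := nf; rewrite normal_form_cons => /and3P[ntv nf' vw].
by rewrite wmul_letter_cons //=; have [] := IHs nf'.
Qed.

Lemma onth_wmul_letter s u j : normal_form s -> nontrivial u ->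
  (j.+2 <= size s)%N -> onth (wmul s [:: u]) j = onth s j.
Proof.
move=> + ntu; elim: s j => [//|v [|w s] IHs] j nf //.
have := nf; rewrite normal_form_cons => /and3P[ntv nf' vw].
rewrite wmul_letter_cons //; case: j => [//|j] js.
exact: IHs.
Qed.

End Words.

(** * Harmonic functions on Z/3 * Z/3 *)

Definition ga : 'Z_3 := Zp1.
Definition gb : 'Z_3 := (ga * ga)%g.

Notation Z3letter := (letter 'Z_3 'Z_3).

Lemma Z3_nontrivial (x : 'Z_3) : x != 1%g -> x = ga \/ x = gb.
Proof.
case: x => [[|[|[|?]]] //= lt] _; [left|right]; exact: val_inj.
Qed.

Lemma nontrivial_Z3_ind (Q : Z3letter -> Prop) :
  Q (inl ga) -> Q (inl gb) -> Q (inr ga) -> Q (inr gb) ->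
  forall u, nontrivial u -> Q u.
Proof. by move=> ? ? ? ? [] x /= /Z3_nontrivial[] ->. Qed.

Section Z3words.
Variables (R : realFieldType) (p : R).
Hypothesis hp : 0 < p < 1 / 2.
Implicit Types (u v w : Z3letter) (s t : seq Z3letter).

Definition avg (F : Z3letter -> R) : R :=
  p * (F (inl ga) + F (inl gb)) + (1 / 2 - p) * (F (inr ga) + F (inr gb)).

Definition rvec u : R := if in_left u then (1 + 2 * p) / 6 else (1 - p) / 3.

(* [rho u] is the weight [q(u)] of the multiplicative measure, and also the   *)
(* probability that the walk ever visits [u]; hence [hit s] is the            *)
(* probability that the walk started at [s] ever visits the identity.         *)
Definition rho u : R :=
  if in_left u then (1 + 2 * p) / (4 * (1 - p)) else (1 - p) / (1 + 2 * p).

Definition hit s : R := \prod_(u <- s) rho u.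

(** The mass q(u_1)...q(u_{n-1}) r(u_n) that the multiplicative measure gives to the cylinder of
    [t], with [rho] as q. *)
Fixpoint cylw t : R :=
  if t is u :: t' then (if t' is [::] then rvec u else rho u * cylw t') else 1.

(* The probability that the walk started at [s] converges to an infinite word *)
(* with prefix [t].                                                           *)
Fixpoint cylprob t s : R :=
  if t is u :: t' then
    if s is v :: s' then
      if v == u then
        (if t' is [::] then 1 - 2 * rvec u * hit s' else cylprob t' s')
      else if same_factor v u then hit s' * cylw t else hit s * cylw t
    else cylw t
  else 1.

Lemma hit_cons u s : hit (u :: s) = rho u * hit s.
Proof. exact: big_cons. Qed.

Lemma hit_nil : hit [::] = 1. Proof. exact: big_nil. Qed.

Lemma wmul_ga_gb : ((ga * gb)%g = 1%g) * ((gb * ga)%g = 1%g) * ((gb * gb)%g = ga).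
Proof. by do !split; apply: val_inj. Qed.

(** In Z/3 the two nontrivial elements of the factor of [v] send [v] to 1 and to its inverse, since
    v^2 = v^-1. *)
Lemma avg_wmul1 (F : seq Z3letter -> R) v : nontrivial v ->
  avg (fun u => F (wmul [:: v] [:: u])) =
  if in_left v then p * (F [::] + F [:: linv v]) +
    (1 / 2 - p) * (F [:: v; inr ga] + F [:: v; inr gb])
  else p * (F [:: v; inl ga] + F [:: v; inl gb]) +
    (1 / 2 - p) * (F [::] + F [:: linv v]).
Proof.
have ia : (ga^-1)%g = gb by apply: val_inj.
have ib : (gb^-1)%g = ga by apply: val_inj.
rewrite /avg; move: v; apply: nontrivial_Z3_ind;
rewrite !wmul1E /= /lcons /= ?wmul_ga_gb -?/gb ?ia ?ib; ring.
Qed.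

Let p0 : 0 < p. Proof. by case/andP: hp. Qed.
Let p1 : p < 1 / 2. Proof. by case/andP: hp. Qed.
Let nz1 : 1 - p != 0. Proof. rewrite gt_eqF //; have := p0; have := p1; lra. Qed.
Let nz2 : 1 + 2 * p != 0. Proof. rewrite gt_eqF //; have := p0; have := p1; lra. Qed.

(** For one letter this is the first-step system rho_a = p(1 + rho_a) + (1 - 2p) rho_a rho_b and its
    analogue for b, which [rho] solves. In longer words the first letter contributes a constant
    factor. The identity is excluded: there [hit] exceeds its mean. *)
Lemma avg_hit s : normal_form s -> s != [::] ->
  avg (fun u => hit (wmul s [:: u])) = hit s.
Proof.
elim: s => // v [|w s] IHs nf _; have := nf;
  rewrite normal_form_cons => /and3P[ntv nf' vw].
  rewrite avg_wmul1 // !hit_cons !hit_nil /rho.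
  by case: v {nf vw IHs ntv} => x /=; field; rewrite ?nz1 ?nz2.
by rewrite hit_cons -(IHs nf' isT) /avg !wmul_letter_cons // !hit_cons; ring.
Qed.

(** * Harmonicity of the cylinder probabilities *)

Definition harm t s := avg (fun u => cylprob t (wmul s [:: u])) = cylprob t s.

(** Left translation explains the branches. From [v :: s], the first letter can change only after a
    visit to [v], of probability [hit s]. From [u] itself, the limit loses [u] when the translated
    walk starts in the factor of [u], of probability 2 r(u). From the other letter of that factor,
    the translated walk must start with one prescribed letter, of the same weight as [u]. From the
    other factor, the identity must be visited. *)
Lemma cylprob_cons u t v s : cylprob (u :: t) (v :: s) =
  if v == u then (if t is [::] then 1 - 2 * rvec u * hit s else cylprob t s)
  else (if same_factor v u then hit s else hit (v :: s)) * cylw (u :: t).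
Proof. by rewrite /=; case: eqP => //; case: ifP. Qed.

Lemma cylw_rho u t : t != [::] -> cylw (u :: t) = rho u * cylw t.
Proof. by case: t. Qed.

Lemma cylprob_nil t : cylprob t [::] = cylw t.
Proof. by case: t. Qed.

Lemma cylprob_harm0 t : normal_form t -> harm t [::].
Proof.
case: t => [_|c t]; first by rewrite /harm /avg /=; field.
rewrite normal_form_cons => /and3P[ntc _ _].
rewrite /harm /avg /= !hit_cons !hit_nil.
move: c ntc; apply: nontrivial_Z3_ind; rewrite /= ?eqxx /=; case: t => [|d t];
rewrite ?hit_nil /rho /rvec /=; by field; rewrite ?nz1 ?nz2.
Qed.

Lemma cylprob_harm1 t v : normal_form t -> nontrivial v -> harm t [:: v].
Proof.
case: t => [_ _|u t]; first by rewrite /harm /avg /=; field.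
rewrite normal_form_cons => /and3P[ntu nft ut] ntv.
(* When [v] is [u] and the prefix goes on, deleting the common letter moves the walk to the
   identity, with a shorter prefix. *)
have IH := cylprob_harm0 nft.
rewrite /harm avg_wmul1 // !cylprob_cons !hit_cons !hit_nil.
case: t ut nft IH => [_ _ _|c t uc].
  move: u ntu; apply: nontrivial_Z3_ind; move: v ntv; apply: nontrivial_Z3_ind;
    rewrite /= ?hit_nil /rho /rvec /=; by field; rewrite ?nz1 ?nz2.
rewrite normal_form_cons => /and3P[ntc _ _].
rewrite /harm /avg !cylprob_nil (cylw_rho u (isT : c :: t != [::])).
(* The rest of the prefix starts in the other factor, so from a letter of the factor of [u] the walk
   must first visit the identity. *)
have : if in_left u then cylprob (c :: t) [:: inl ga] = rho (inl ga) * cylw (c :: t) /\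
    cylprob (c :: t) [:: inl gb] = rho (inl gb) * cylw (c :: t)
  else cylprob (c :: t) [:: inr ga] = rho (inr ga) * cylw (c :: t) /\
    cylprob (c :: t) [:: inr gb] = rho (inr gb) * cylw (c :: t).
  case: c uc ntc => y uc _; case: u ntu uc => z //= _ _;
  by rewrite !hit_cons !hit_nil !mulr1.
move: (cylw (c :: t)) (cylprob (c :: t)) => W K.
move: u ntu {uc}; apply: nontrivial_Z3_ind; move: v ntv; apply: nontrivial_Z3_ind.
all: rewrite /= ?eqxx /= => -[-> ->]; rewrite /rho /= => IH.
all: by first [exact: IH | rewrite -{4}IH; field; rewrite ?nz1 ?nz2
  | field; rewrite ?nz1 ?nz2 | move: IH; lra].
Qed.

(** If [s] has at least two letters, the first one stays. When it matches and the prefix goes on,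
    both words lose it; otherwise the probability is affine in [hit] of a nonempty word, which is
    harmonic. *)
Lemma cylprob_harm t s : normal_form t -> normal_form s -> harm t s.
Proof.
elim: t s => [|u t' IHt] s nft nfs.
  by rewrite /harm /avg /=; field.
case: s nfs => [|v [|w s]] nfs; first exact: cylprob_harm0.
  by apply: cylprob_harm1 => //; move: nfs; rewrite normal_form_cons => /andP[].
have nft' : normal_form t' by move: nft; rewrite normal_form_cons => /and3P[].
have := nfs; rewrite normal_form_cons => /and3P[ntv nfs' vw].
have hE := avg_hit nfs' isT.
rewrite /harm /avg !wmul_letter_cons // !cylprob_cons.
case: eqP => [_|_].
  case: t' {nft} IHt nft' => [|c t'] IHt nft'; last exact: (IHt (w :: s) nft' nfs').
  by rewrite -hE /avg; field.
by case: ifP => _; rewrite ?(hit_cons v) -hE /avg; ring.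
Qed.

(** * Geometric decay of the hitting probabilities *)

Let rho_gt0 u : 0 < rho u.
Proof.
by rewrite /rho; case: ifP => _; rewrite divr_gt0 //; have := p0; have := p1; lra.
Qed.

Definition rhomax : R := Num.max (rho (inl ga)) (rho (inr ga)).

Lemma rho_le_max u : rho u <= rhomax.
Proof. by rewrite /rhomax /rho le_max; case: u => x /=; rewrite lexx ?orbT. Qed.

Lemma rhomax_gt0 : 0 < rhomax.
Proof. exact: lt_le_trans (rho_gt0 (inl ga)) (rho_le_max _). Qed.

(** The two bounds amount to p < 1/2 and p > 0. *)
Lemma rhomax_lt1 : rhomax < 1.
Proof.
by rewrite /rhomax /rho gt_max /= !ltr_pdivrMr; have := p0; have := p1; lra.
Qed.

Lemma hit_ge0 s : 0 <= hit s.
Proof. by apply: prodr_ge0 => u _; exact: ltW. Qed.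

Lemma hit_le s : hit s <= rhomax ^+ size s.
Proof.
elim: s => [|u s IHs]; first by rewrite hit_nil.
by rewrite hit_cons exprS ler_pM ?hit_ge0 ?rho_le_max // ltW.
Qed.

Lemma hit_le1 s : hit s <= 1.
Proof.
by apply: le_trans (hit_le s) _; rewrite exprn_ile1 ?ltW ?rhomax_gt0 ?rhomax_lt1.
Qed.

Lemma rvec_bounds u : 0 < rvec u < 1 / 2.
Proof. by rewrite /rvec; case: ifP => _; have := p0; have := p1; lra. Qed.

Lemma cylw_bounds t : 0 <= cylw t <= 1.
Proof.
elim: t => [|u [|v t] IHt]; first by rewrite /= ler01 lexx.
  by have := rvec_bounds u; rewrite /=; lra.
rewrite cylw_rho //; have /andP[c0 c1] := IHt.
rewrite mulr_ge0 ?(ltW (rho_gt0 _)) //= mulr_ile1 ?(ltW (rho_gt0 _)) //.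
by apply: le_trans (rho_le_max _) _; rewrite ltW ?rhomax_lt1.
Qed.

Lemma cylprob_bounds t s : 0 <= cylprob t s <= 1.
Proof.
elim: t s => [|u t IHt] [|v s]; rewrite ?cylprob_nil ?cylw_bounds //.
  by rewrite /= ler01 lexx.
have := hit_ge0 s; have := hit_le1 s; have := rvec_bounds u => ru h1 h0.
rewrite cylprob_cons; case: eqP => _.
  by case: t {IHt} (IHt s) => // _; nra.
have /andP[c0 c1] := cylw_bounds (u :: t).
by case: ifP => _; rewrite mulr_ge0 ?mulr_ile1 ?hit_ge0 ?hit_le1.
Qed.

(** The error always carries [hit] of the part of [s] left when the comparison with [t] is decided.
    If [s] is shorter than [t], the truncated exponent is 0 and the bound is trivial. *)
Lemma cylprob_approx t s :
  `|cylprob t s - (prefix t s)%:R| <= 2 * rhomax ^+ (size s - size t).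
Proof.
have m01 n : 0 < rhomax ^+ n <= 1.
  by rewrite exprn_gt0 ?rhomax_gt0 // exprn_ile1 ?ltW ?rhomax_gt0 ?rhomax_lt1.
elim: t s => [|u t IHt] [|v s].
- by rewrite /= subrr normr0 mulr_ge0 // ltW //; case/andP: (m01 (0 - 0)%N).
- by rewrite /= subrr normr0 mulr_ge0 // ltW //; case/andP: (m01 ((size s).+1 - 0)%N).
- by rewrite cylprob_nil subr0 ler_norml sub0n expr0; have := cylw_bounds (u :: t); lra.
rewrite cylprob_cons prefix_cons subSS.
rewrite [v == u]eq_sym; have [_|_] := eqVneq u v.
  case: t {IHt} (IHt s) => [_|//]; rewrite prefix0s subn0 mulr1n.
  have hl := hit_le s; have h0 := hit_ge0 s; have /andP[ru0 ru1] := rvec_bounds u.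
  have rh0 : 0 <= rvec u * hit s by rewrite mulr_ge0 // ltW.
  have rh1 : rvec u * hit s <= 1 / 2 * hit s by rewrite ler_wpM2r // ltW.
  rewrite ler_norml; lra.
rewrite subr0.
have hs : hit s <= rhomax ^+ (size s - size t).
  apply: le_trans (hit_le s) _.
  by rewrite ler_wiXn2l ?leq_subr ?ltW ?rhomax_gt0 ?rhomax_lt1.
have hvs : hit (v :: s) <= hit s.
  by rewrite hit_cons ler_piMl ?hit_ge0 // (le_trans (rho_le_max _)) ?ltW ?rhomax_lt1.
have /andP[c0 c1] := cylw_bounds (u :: t).
have h0 := hit_ge0 s; have hv0 := hit_ge0 (v :: s).
by case: ifP => _; rewrite ger0_norm ?mulr_ge0 //; nra.
Qed.

(** * The Poisson equation for the length *)

Definition speed : R := 2 * p * (1 - 2 * p).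

(** The weights add up to 2, so that an alternating word weighs about its length, and they make the
    mean increment the same whichever factor the last letter is in. *)
Definition wt u : R := if in_left u then 2 - 4 * p else 4 * p.

Definition wsum s : R := \sum_(u <- s) wt u.

(** The denominator is the probability of never returning to the identity, that is, the drop in the
    mean of [hit] there; the numerator is the excess increment of [wsum]. *)
Definition cpot : R :=
  3 * speed / (1 - 2 * p * rho (inl ga) - (1 - 2 * p) * rho (inr ga)).

(* The mean increment of [wsum] is [speed] except at the identity, where it   *)
(* is [4 * speed]. Since [hit] is harmonic except at the identity, a suitable *)
(* multiple of it absorbs the excess.                                         *)
Definition pot s : R := wsum s + cpot * hit s.

Lemma cpot_den_gt0 : 0 < 1 - 2 * p * rho (inl ga) - (1 - 2 * p) * rho (inr ga).
Proof.
have := rho_le_max (inl ga); have := rho_le_max (inr ga); have := rhomax_lt1.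
have := p0; have := p1; nra.
Qed.

Lemma cpot_ge0 : 0 <= cpot.
Proof.
rewrite divr_ge0 ?(ltW cpot_den_gt0) // /speed; have := p0; have := p1; nra.
Qed.

Lemma avg_pot s : normal_form s ->
  avg (fun u => pot (wmul s [:: u])) = pot s + speed.
Proof.
move=> nfs.
have avgD (F1 F2 : Z3letter -> R) :
    avg (fun u => F1 u + cpot * F2 u) = avg F1 + cpot * avg F2.
  by rewrite /avg; ring.
rewrite (avgD (fun u => wsum (wmul s [:: u])) (fun u => hit (wmul s [:: u]))) /pot.
case: s nfs => [_|v s nfs].
  rewrite /avg /= !hit_cons !hit_nil /wsum !big_cons !big_nil /wt /=.
  have := cpot_den_gt0.
  have : cpot * (1 - 2 * p * rho (inl ga) - (1 - 2 * p) * rho (inr ga)) =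
      3 * speed.
    by rewrite /cpot divfK // gt_eqF // cpot_den_gt0.
  have -> : rho (inl gb) = rho (inl ga) by [].
  have -> : rho (inr gb) = rho (inr ga) by [].
  rewrite /speed; lra.
rewrite avg_hit // [RHS]addrAC; congr (_ + _).
elim: s v nfs => [|w s IHs] v nfs; have := nfs;
  rewrite normal_form_cons => /and3P[ntv nfs' _].
  rewrite (avg_wmul1 wsum) // /wsum !big_cons !big_nil /wt /speed.
  by case: v {nfs ntv} => x /=; field.
have wc c z : wsum (c :: z) = wt c + wsum z by exact: big_cons.
by rewrite (wc v) -addrA -(IHs _ nfs') /avg !wmul_letter_cons // !(wc v); field.
Qed.

(** Consecutive letters alternate between the factors and pair up to weight 2. An odd word begins
    and ends in the same factor, which leaves one weight minus 1. *)
Lemma wsumE s : normal_form s ->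
  wsum s = (size s)%:R +
    if odd (size s) then
      (if in_left (head (inl ga) s) then 1 - 4 * p else 4 * p - 1)
    else 0.
Proof.
rewrite /wsum; elim: s => [|u s IHs]; first by rewrite big_nil addr0.
rewrite normal_form_cons => /and3P[_ nfs us].
rewrite big_cons IHs //= -natr1 /wt.
case: s us {IHs nfs} => [|v s] us /=; first by case: ifP => _; ring.
move: us; rewrite same_factorE.
by case: (odd _); case: (in_left u); case: (in_left v) => //= _; ring.
Qed.

Lemma pot_size s : normal_form s -> `|pot s - (size s)%:R| <= 1 + cpot.
Proof.
move=> nfs; rewrite /pot wsumE // addrAC.
have := hit_le1 s; have := hit_ge0 s; have := cpot_ge0; have := p0; have := p1.
rewrite ler_norml; case: ifP => _; [case: ifP => _|]; nra.
Qed.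

(** Two errors of [pot_size] give 2 + 2 [cpot]; the change of length and [speed] each add at most
    1. *)
Definition stepbound : R := 4 + 2 * cpot.

Lemma pot_step s u : normal_form s -> nontrivial u ->
  `|pot (wmul s [:: u]) - pot s - speed| <= stepbound.
Proof.
move=> nfs ntu; have [] := size_wmul_letter nfs ntu.
have := pot_size nfs; have := pot_size (wmul_nf s (t := [:: u]) _).
rewrite !ler_norml normal_form_cons ntu => /(_ isT).
rewrite -!(ler_nat R) -!natr1 /stepbound /speed.
have := p0; have := p1; nra.
Qed.

(** * Moments of a centred bounded increment *)

Lemma avg_pow4 (M K : R) (D : Z3letter -> R) :
  (forall u, nontrivial u -> `|D u| <= K) -> avg D = 0 ->
  avg (fun u => (M + D u) ^+ 4) <= M ^+ 4 + 8 * K ^+ 2 * M ^+ 2 + 3 * K ^+ 4.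
Proof.
move=> DK D0.
have le4 u : nontrivial u ->
    (M + D u) ^+ 4 <= M ^+ 4 + 8 * K ^+ 2 * M ^+ 2 + 3 * K ^+ 4 + 4 * M ^+ 3 * D u.
  move=> /DK; move: (D u) => d dK.
  have d2 : d ^+ 2 <= K ^+ 2.
    by rewrite -real_normK ?num_real // lerXn2r ?nnegrE // (le_trans (normr_ge0 _) dK).
  (* The cubic term 4 M d^3 is split as 2 d^2 times 2 M d, and 2 M d is at most M^2 + d^2; hence 8 =
     6 + 2 and 3 = 1 + 2. The term linear in d averages to zero. *)
  have e : (M + d) ^+ 4 = M ^+ 4 + 4 * M ^+ 3 * d + 6 * d ^+ 2 * M ^+ 2 +
    2 * d ^+ 2 * (2 * (M * d)) + d ^+ 2 * d ^+ 2 by ring.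
  have a1 : 2 * (M * d) <= M ^+ 2 + d ^+ 2.
    by rewrite -subr_ge0 (_ : _ - _ = (M - d) ^+ 2) ?sqr_ge0 //; ring.
  have M2 : 0 <= M ^+ 2 by exact: sqr_ge0.
  have dd : 0 <= d ^+ 2 by exact: sqr_ge0.
  have a2 : 2 * d ^+ 2 * (2 * (M * d)) <= 2 * d ^+ 2 * (M ^+ 2 + d ^+ 2).
    by rewrite ler_wpM2l // mulr_ge0.
  have a3 : d ^+ 2 * M ^+ 2 <= K ^+ 2 * M ^+ 2 by rewrite ler_wpM2r.
  have a4 : d ^+ 2 * d ^+ 2 <= K ^+ 4 by rewrite (exprD K 2 2) ler_pM.
  move: e a2; rewrite mulrDr; lra.
have := le4 (inl ga) isT; have := le4 (inl gb) isT.
have := le4 (inr ga) isT; have := le4 (inr gb) isT.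
move: D0; rewrite /avg; set Z := M ^+ 4 + _ + _.
move=> D0 h1 h2 h3 h4.
have : p * (M ^+ 3 * (D (inl ga) + D (inl gb))) +
    (1 / 2 - p) * (M ^+ 3 * (D (inr ga) + D (inr gb))) = 0.
  by rewrite -(mulr0 (M ^+ 3)) -D0; ring.
have := p0; have := p1; nra.
Qed.

Lemma avg_pow2 (M K : R) (D : Z3letter -> R) :
  (forall u, nontrivial u -> `|D u| <= K) -> avg D = 0 ->
  avg (fun u => (M + D u) ^+ 2) <= M ^+ 2 + K ^+ 2.
Proof.
move=> DK D0.
have le2 u : nontrivial u -> (D u) ^+ 2 <= K ^+ 2.
  move=> /DK dK.
  by rewrite -real_normK ?num_real // lerXn2r ?nnegrE // (le_trans (normr_ge0 _) dK).
have := le2 (inl ga) isT; have := le2 (inl gb) isT.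
have := le2 (inr ga) isT; have := le2 (inr gb) isT.
have -> : avg (fun u => (M + D u) ^+ 2) =
    M ^+ 2 + 2 * M * avg D + avg (fun u => D u ^+ 2).
  by rewrite /avg; field.
rewrite D0 /avg; have := p0; have := p1; nra.
Qed.

End Z3words.

(** * Moments of the martingale *)

(** By monotone convergence the series of the [h n] has a finite integral, so it converges almost
    everywhere and its terms tend to 0. *)
Lemma ae_cvg0_summable (d : measure_display) (T : measurableType d) (R : realType)
    (P : {measure set T -> \bar R}) (h : nat -> T -> R) (c : nat -> R) (C : R) :
  (forall n, measurable_fun setT (h n)) -> (forall n w, 0 <= h n w) ->
  (forall n, (\int[P]_w (h n w)%:E <= (c n)%:E)%E) ->
  (forall N, \sum_(0 <= n < N) c n <= C) ->
  {ae P, forall w, h n w @[n --> \oo] --> 0}.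
Proof.
move=> mh h0 hc cC.
have h0E n w : (0 <= (h n w)%:E)%E by rewrite lee_fin.
have mhE n : measurable_fun setT (fun w => (h n w)%:E) by exact/measurable_EFinP.
pose S w := (\sum_(n <oo) (h n w)%:E)%E.
have S0 w : (0 <= S w)%E by exact: nneseries_ge0.
have mS : measurable_fun setT S by exact: (ge0_emeasurable_sum (P := xpredT)).
have intS : (\int[P]_w S w <= C%:E)%E.
  rewrite integral_nneseries //; apply: lime_le.
    by apply: is_cvg_nneseries => n _ _; exact: integral_ge0.
  apply: nearW => N; apply: le_trans (_ : (\sum_(0 <= n < N) (c n)%:E <= _)%E).
    exact: lee_sum.
  by rewrite sumEFin lee_fin.
have iS : P.-integrable setT S.
  apply/integrableP; split => //.
  under eq_integral do rewrite gee0_abs //.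
  exact: le_lt_trans intS (ltry _).
apply: filterS (integrable_ae measurableT iS) => w /(_ I) Sfin.
have sm : summable xpredT (fun n => (h n w)%:E).
  rewrite /summable; under eq_esum do rewrite gee0_abs //.
  by rewrite -nneseries_esum // ltey_eq Sfin.
have := summable_cvg (fun n _ => h0E n w) sm.
exact: cvg_series_cvg_0.
Qed.

Lemma sum_inv_sqr_le (R : realFieldType) N :
  \sum_(0 <= n < N) n.+1%:R ^- 2 <= 2 :> R.
Proof.
have h n : n.+1%:R ^- 2 <= 2 * (n.+1%:R^-1 - n.+2%:R^-1) :> R.
  have a0 : 1 <= n.+1%:R :> R by rewrite ler1n.
  rewrite -[n.+2%:R]natr1; move: n.+1%:R a0 => a a1.
  (* The bound telescopes; its excess over the inverse square is nonnegative because a is at least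
     1. *)
  have -> : 2 * (a^-1 - (a + 1)^-1) = a ^- 2 + (a - 1) / (a ^+ 2 * (a + 1)).
    by field; rewrite !gt_eqF //; lra.
  by rewrite lerDl divr_ge0 ?mulr_ge0 ?sqr_ge0 //; lra.
have : \sum_(0 <= n < N) n.+1%:R ^- 2 <= 2 * (1 - N.+1%:R^-1) :> R.
  elim: N => [|N IHN]; first by rewrite big_nil invr1 subrr mulr0.
  rewrite big_nat_recr //=; apply: le_trans (lerD IHN (h N)) _.
  by rewrite -mulrDr addrA subrK.
by move=> /le_trans; apply; rewrite ler_piMr // gerBl invr_ge0.
Qed.

Lemma cvg0_expr4 (R : realType) (u : nat -> R) :
  u n ^+ 4 @[n --> \oo] --> 0 -> u n @[n --> \oo] --> 0.
Proof.
move=> /cvgr0Pnorm_lt u4; apply/cvgr0Pnorm_lt => e e0.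
near=> n.
rewrite -(@ltr_pXn2r _ 4) ?nnegrE ?normr_ge0 ?(ltW e0) //.
rewrite -normrX; near: n; apply: u4; exact: exprn_gt0.
Unshelve. all: by end_near. Qed.

Section TransitionOperator.
Variables (R : realFieldType) (p : R).
Hypothesis hp : 0 < p < 1 / 2.
Local Notation fp := (freeprod 'Z_3 'Z_3).

Definition avgmul (F : fp -> R) (g : fp) : R :=
  avg p (fun u => F (g * fp_letter u)%g).

(** Powers of the transition operator are linear, so the mean over the last step can be moved
    inside. This reassembles the law of step n + 1 in [expectation_future]. *)
Lemma iter_avgmul_avg n (F : Z3letter -> fp -> R) g :
  iter n avgmul (fun h => avg p (fun u => F u h)) g =
  avg p (fun u => iter n avgmul (F u) g).
Proof.
elim: n F g => [//|n IHn] F g; rewrite iterSr.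
rewrite (_ : avgmul (fun h => avg p (fun u => F u h)) =
  (fun h => avg p (fun u => avgmul (F u) h))); last first.
  by apply/funext => h; rewrite /avgmul /avg; ring.
by rewrite (IHn (fun u => avgmul (F u))) /avg -!iterSr.
Qed.

Lemma iter_avgmul_affine n (F G : fp -> R) (c e : R) g :
  iter n avgmul (fun h => F h + c * G h + e) g =
  iter n avgmul F g + c * iter n avgmul G g + e.
Proof.
elim: n F G g => [//|n IHn] F G g; rewrite !iterSr -IHn.
by congr (iter n _ _ _); apply/funext => h; rewrite /avgmul /avg; field.
Qed.

Lemma iter_avgmul_le n (F G : fp -> R) g :
  (forall h, F h <= G h) -> iter n avgmul F g <= iter n avgmul G g.
Proof.
case/andP: hp => p0 p1.
elim: n F G g => [//|n IHn] F G g FG; rewrite !iterSr; apply: IHn => h.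
by rewrite /avgmul /avg lerD // ler_wpM2l ?lerD ?subr_ge0 ?FG // ltW.
Qed.

Lemma iter_avgmul_harmonic n (F : fp -> R) g :
  (forall h, avgmul F h = F h) -> iter n avgmul F g = F g.
Proof. by move=> /funext hF; elim: n => [//|n IHn]; rewrite iterSr hF. Qed.

Lemma avgmul_word (F : seq Z3letter -> R) g :
  avgmul (fun h => F (fpword h)) g = avg p (fun u => F (wmul (fpword g) [:: u])).
Proof. by rewrite /avgmul /avg !fpwordM_letter. Qed.

Definition mart n (g : fp) : R := pot p g - pot p [::] - n%:R * speed p.

Lemma avgmul_mart n g (k : R -> R) :
  avgmul (fun h => k (mart n.+1 h)) g =
  avg p (fun u => k (mart n g + (pot p (wmul g [:: u]) - pot p g - speed p))).
Proof.
have E u : nontrivial u -> mart n.+1 (g * fp_letter u)%g =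
    mart n g + (pot p (wmul g [:: u]) - pot p g - speed p).
  by move=> ntu; rewrite /mart fpwordM_letter // -natr1; ring.
by rewrite /avgmul /avg !E.
Qed.

Let avg0 (g : fp) : avg p (fun u => pot p (wmul g [:: u]) - pot p g - speed p) = 0.
Proof.
have := avg_pot hp (valP g); rewrite /avg; lra.
Qed.

Local Notation K := (stepbound p).

Lemma mart2_bound n : iter n avgmul (fun g => mart n g ^+ 2) 1%g <= n%:R * K ^+ 2.
Proof.
elim: n => [|n IHn]; first by rewrite /= /mart /= subrr !mul0r subr0 expr0n.
rewrite iterSr.
(* The term [0 * 0] only gives the bound the shape that [iter_avgmul_affine] expects. *)
have le1 g : avgmul (fun g => mart n.+1 g ^+ 2) g <= mart n g ^+ 2 + 0 * 0 + K ^+ 2.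
  rewrite (avgmul_mart n g (fun y => y ^+ 2)) mul0r addr0.
  by apply: avg_pow2 => // u ntu; apply: pot_step => //; exact: valP.
apply: le_trans (iter_avgmul_le n 1%g le1) _.
by rewrite (iter_avgmul_affine n _ (fun=> 0)) mul0r addr0 -natr1 mulrDl mul1r lerD2r.
Qed.

(** One step adds at most 8nK^4 + 3K^4 by the second moment bound, and this is below 4K^4((n+1)^2 -
    n^2) = 8nK^4 + 4K^4. *)
Lemma mart4_bound n :
  iter n avgmul (fun g => mart n g ^+ 4) 1%g <= 4 * K ^+ 4 * n%:R ^+ 2.
Proof.
elim: n => [|n IHn].
  by rewrite /= /mart /= subrr !mul0r subr0 !expr0n mulr0.
rewrite iterSr.
have le1 g : avgmul (fun g => mart n.+1 g ^+ 4) g <=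
    mart n g ^+ 4 + 8 * K ^+ 2 * mart n g ^+ 2 + 3 * K ^+ 4.
  rewrite (avgmul_mart n g (fun y => y ^+ 4)).
  by apply: avg_pow4 => // u ntu; apply: pot_step => //; exact: valP.
apply: le_trans (iter_avgmul_le n 1%g le1) _.
rewrite iter_avgmul_affine -[n.+1%:R]natr1.
have K2 : 0 <= K ^+ 2 by exact: sqr_ge0.
have h := ler_wpM2l (mulr_ge0 (ler0n _ 8) K2) (mart2_bound n).
have -> : 4 * K ^+ 4 * (n%:R + 1) ^+ 2 = 4 * K ^+ 4 * n%:R ^+ 2 +
  8 * K ^+ 2 * (n%:R * K ^+ 2) + 3 * K ^+ 4 + K ^+ 4 by ring.
have K4 : 0 <= K ^+ 4 by rewrite (exprD K 2 2) mulr_ge0.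
lra.
Qed.

End TransitionOperator.

(** * Limit words *)

Section LimitWord.
Variables G1 G2 : finGroupType.
Implicit Types (g : nat -> freeprod G1 G2) (xi : infword G1 G2).

Lemma letterwise_cvg_take g xi k : letterwise_cvg g xi ->
  \forall n \near \oo, take k (fpword (g n)) = mkseq xi k.
Proof.
move=> gxi; elim: k => [|k IHk]; first by apply: nearW => n; rewrite take0.
near=> n.
have tk : take k (fpword (g n)) = mkseq xi k by near: n.
have ok : onth (fpword (g n)) k = Some (xi k) by near: n; exact: gxi.
have kn : (k < size (fpword (g n)))%N by rewrite -onthTE ok.
by rewrite (take_nth (xi k)) // mkseqS tk (onth_nth _ _ _ _ ok).
Unshelve. all: by end_near. Qed.

Lemma letterwise_cvg_size g xi k : letterwise_cvg g xi ->
  \forall n \near \oo, (k <= fplength (g n))%N.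
Proof.
move=> gxi; have := gxi k; apply: filterS => n ok.
by apply: ltnW; rewrite -onthTE ok.
Qed.

(** Every finite prefix of the limit is a prefix of some normal form, and normality only constrains
    letters and consecutive pairs. *)
Lemma letterwise_cvg_nf g xi : letterwise_cvg g xi -> inf_normal_form xi.
Proof.
move=> gxi.
have nf k : normal_form (mkseq xi k).
  near \oo => n.
  have <- : take k (fpword (g n)) = mkseq xi k.
    by near: n; exact: letterwise_cvg_take.
  have /andP[aS sS] := valP (g n); rewrite /normal_form take_sorted // andbT.
  by apply/allP => u /mem_take; exact: (allP aS).
split => j.
  have /andP[/allP + _] := nf j.+1; apply.
  by rewrite -{1}(nth_mkseq (xi j) xi (ltnSn j)) mem_nth ?size_mkseq.
have /andP[_] := nf j.+2; rewrite /mkseq -addn2 iotaD map_cat /= add0n.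
by move=> /cat_sorted2[_] /=; rewrite andbT.
Unshelve. all: by end_near. Qed.

(** Where the j-th letter does not stabilise, [get] returns [point]; the map is thus total, as a
    random variable must be. *)
Definition letter_limit g : infword G1 G2 :=
  fun j => get [set u | \forall n \near \oo, onth (fpword (g n)) j = Some u].

Lemma letter_limit_uniq g j u v :
  (\forall n \near \oo, onth (fpword (g n)) j = Some u) ->
  (\forall n \near \oo, onth (fpword (g n)) j = Some v) -> u = v.
Proof.
move=> gu gv; have [N _ HN] := filterI gu gv.
by have [/= -> []] := HN N (leqnn N).
Qed.

(** Once the length stays at least j + 2, the j-th letter is never the last one, so no step alters
    it. *)
Lemma letter_limit_cvg g :
  (forall n, exists2 u, nontrivial u & g n.+1 = (g n * fp_letter u)%g) ->
  (forall k, \forall n \near \oo, (k <= fplength (g n))%N) ->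
  letterwise_cvg g (letter_limit g).
Proof.
move=> gS goo j; have [N _ HN] := goo j.+2.
have Nj : (j.+2 <= fplength (g N))%N by exact: HN (leqnn N).
apply: (@getPex _ [set u | \forall n \near \oo, onth (fpword (g n)) j = Some u]).
case E : (onth (fpword (g N)) j) => [u|]; last first.
  by have := onthTE (fpword (g N)) j; rewrite E /= => /esym/negbT;
    rewrite -leqNgt leqNgt ltnW.
exists u; exists N => // n /= Nn; rewrite -E -(subnKC Nn).
elim: (n - N)%N => [|m IHm]; first by rewrite addn0.
rewrite -IHm addnS; have [v ntv ->] := gS (N + m)%N.
rewrite fpwordM_letter // onth_wmul_letter //; first exact: valP.
by apply: HN => /=; exact: leq_addr.
Qed.

Lemma measurable_cylinder (s : seq (letter G1 G2)) :
  measurable (@cylinder G1 G2 s : set (infword G1 G2)).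
Proof. by apply: sub_sigma_algebra; exists s. Qed.

Lemma measurable_prefix k (Q : pred (seq (letter G1 G2))) :
  measurable [set xi : infword G1 G2 | Q (mkseq xi k)].
Proof.
rewrite (_ : [set _ | _] = \bigcup_(s in [set: seq (letter G1 G2)])
    (if Q s && (size s == k) then @cylinder G1 G2 s else set0)).
  apply: countable_bigcupT_measurable => [|s]; first exact: countableP.
  by case: ifP => _; [exact: measurable_cylinder|exact: measurable0].
apply/seteqP; split => xi /=.
  by move=> Qxi; exists (mkseq xi k) => //;
    rewrite Qxi size_mkseq eqxx /cylinder /= size_mkseq.
case=> s _; case: ifP => // /andP[Qs /eqP <-]; by rewrite /cylinder /= => ->.
Qed.

Lemma measurable_inf_normal_form : measurable (@inf_normal_form G1 G2).
Proof.
pose Q j (s : seq (letter G1 G2)) :=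
  (nth point s j \in Sigma G1 G2) && (nth point s j.+1 \notin Sigma_of (nth point s j)).
rewrite (_ : @inf_normal_form G1 G2 =
    \bigcap_j [set xi : infword G1 G2 | Q j (mkseq xi j.+2)]).
  by apply: bigcapT_measurable => j; exact: measurable_prefix.
apply/seteqP; split => xi.
  by move=> [h1 h2] j _; rewrite /= /Q !nth_mkseq // h1 h2.
move=> h; split => j; have := h j I; rewrite /= /Q !nth_mkseq // => /andP[] //.
Qed.

Lemma measurable_letter_limit (d : measure_display) (T : measurableType d)
    (g : nat -> T -> freeprod G1 G2) :
  (forall n A, measurable (g n @^-1` A)) ->
  measurable_fun setT (fun w => letter_limit (g ^~ w)).
Proof.
move=> mg.
pose L j u : set T := [set w | \forall n \near \oo, onth (fpword (g n w)) j = Some u].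
have mL j u : measurable (L j u).
  rewrite (_ : L j u = \bigcup_N \bigcap_n
      (g (N + n)%N @^-1` [set h | onth (fpword h) j = Some u])).
    by apply: bigcupT_measurable => N; apply: bigcapT_measurable => n; exact: mg.
  apply/seteqP; split => w.
    by move=> [N _ HN]; exists N => // n _; apply: HN; exact: leq_addr.
  move=> [N _ HN]; exists N => // n /= Nn.
  by rewrite -(subnKC Nn); exact: HN.
have mj j u : measurable [set w | letter_limit (g ^~ w) j = u].
  pose D : set T := [set w | u = point].
  have mD : measurable D.
    have [up|up] := pselect (u = point).
      by rewrite (_ : D = setT) //; apply/seteqP; split => // w _; exact: up.
    by rewrite (_ : D = set0) //; apply/seteqP; split => // w /up.
  (* Either [u] is the limit letter, or no limit exists and [u] is the default value. *)
  rewrite (_ : [set _ | _] = L j u `|` (D `&` ~` (\bigcup_v L j v))).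
    apply: measurableU => //; apply: measurableI => //; apply: measurableC.
    by apply: countable_bigcupT_measurable => //; exact: countableP.
  apply/seteqP; split => w /=.
    have [ex|nex] := pselect (exists v, L j v w).
      by move=> <-; left; exact: (getPex ex).
    have e : letter_limit (g ^~ w) j = point.
      by apply: getPN => v Lv; apply: nex; exists v.
    move=> eu; right; split; first by rewrite /D /= -eu.
    by move=> [v _ Lv]; apply: nex; exists v.
  move=> [Lu|[-> nL]]; last by apply: getPN => v Lv; apply: nL; exists v.
  apply: (@letter_limit_uniq (g ^~ w) j) => //.
  by apply: (@getPex _ (fun v => L j v w)); exists u.
apply: (@measurability _ _ T (infword G1 G2) setT
  (fun w => letter_limit (g ^~ w)) (@cylinders G1 G2)) => // _ [_ [s _ <-] <-].
rewrite setTI (_ : _ @^-1` _ =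
  \bigcap_(j in `I_(size s)) [set w | letter_limit (g ^~ w) j = nth point s j]).
  by apply: fin_bigcap_measurable => //; exact: finite_II.
apply/seteqP; split => w.
  by rewrite /cylinder /= => <- j /=; rewrite size_mkseq => js; rewrite nth_mkseq.
move=> h; rewrite /cylinder /=; apply: (@eq_from_nth _ point);
  rewrite size_mkseq // => j js.
by rewrite nth_mkseq //; exact: h.
Qed.

End LimitWord.

(** * The random walk *)

Section Walk.
Variables (R : realType) (p : R).
Hypothesis hp : 0 < p < 1 / 2.
Local Notation fp := (freeprod 'Z_3 'Z_3).
Variable mu : probability fp R.

Definition step_prob (u : Z3letter) : R := if in_left u then p else 1 / 2 - p.

Hypothesis mu_letter : forall u, nontrivial u -> mu [set fp_letter u] = (step_prob u)%:E.
Variables (d : measure_display) (T : measurableType d) (P : probability T R).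
Variable x : nat -> {mfun T >-> fp}.
Hypothesis hx : iid P mu x.

Local Notation X := (fun n w => walk x n w).

Lemma measurable_walk n (A : set fp) : measurable (X n @^-1` A).
Proof.
elim: n A => [|n IHn] A.
  have [A1|A1] := pselect (A 1%g).
    by rewrite (_ : X 0%N @^-1` A = setT) //; apply/seteqP; split.
  by rewrite (_ : X 0%N @^-1` A = set0) //; apply/seteqP; split.
rewrite (_ : X n.+1 @^-1` A =
  \bigcup_(g in [set: fp]) (X n @^-1` [set g] `&` x n @^-1` [set h | A (g * h)%g])).
  apply: countable_bigcupT_measurable => [|g]; first exact: countableP.
  apply: measurableI; first exact: IHn.
  by rewrite -[_ @^-1` _]setTI; apply: (measurable_funPT (x n)).
apply/seteqP; split => w /=; first by move=> Aw; exists (X n w).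
by case=> g _ [/= <-].
Qed.

Lemma measurable_fun_walk (d' : measure_display) (E : measurableType d') n (F : fp -> E) :
  measurable_fun setT (fun w => F (X n w)).
Proof. by move=> _ Y mY; rewrite setTI; exact: (measurable_walk n (F @^-1` Y)). Qed.

Definition Z3letters : seq Z3letter := [:: inl ga; inl gb; inr ga; inr gb].

Lemma sum_letters (F : Z3letter -> \bar R) :
  (\sum_(u <- Z3letters) F u = F (inl ga) + (F (inl gb) + (F (inr ga) + F (inr gb))))%E.
Proof. by rewrite /Z3letters !big_cons big_nil adde0. Qed.

Definition is_letter (g : fp) : Prop := exists2 u, nontrivial u & g = fp_letter u.

Lemma Z3lettersP u : (u \in Z3letters) = nontrivial u.
Proof.
apply/idP/idP; first by rewrite !inE => /or4P[] /eqP ->.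
by move: u; apply: nontrivial_Z3_ind.
Qed.

Lemma trivIset_letters (D : set T) n :
  trivIset [set` Z3letters] (fun u => D `&` x n @^-1` [set fp_letter u]).
Proof.
move=> u v /=; rewrite !Z3lettersP => ntu ntv [w [[_ /= ->] [_ /=]]].
exact: fp_letter_inj.
Qed.

Lemma step_meas n (A : set fp) : measurable (x n @^-1` A).
Proof. by rewrite -[_ @^-1` _]setTI; apply: (measurable_funPT (x n)). Qed.

Lemma step_law n A : P (x n @^-1` A) = mu A.
Proof. by have [_ /(_ n A)] := hx; apply. Qed.

(** The four letters already carry mass 2p + 2(1/2 - p) = 1. *)
Lemma not_letter_null n : P (x n @^-1` [set g | ~ is_letter g]) = 0%E.
Proof.
rewrite step_law.
have -> : [set g | ~ is_letter g] =
    ~` (\big[setU/set0]_(u <- Z3letters) [set fp_letter u]).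
  congr (~` _); apply/seteqP; split => g.
    by move=> [u ntu ->]; rewrite -bigcup_seq; exists u => //=; rewrite Z3lettersP.
  by rewrite -bigcup_seq => -[u /=]; rewrite Z3lettersP => ntu ->; exists u.
rewrite probability_setC //.
have -> : mu (\big[setU/set0]_(u <- Z3letters) [set fp_letter u]) = 1%E;
  last by rewrite subee.
have mU (A B : set fp) : A `&` B = set0 -> mu (A `|` B) = (mu A + mu B)%E.
  by move=> AB; rewrite measureU.
have ne (u v : Z3letter) :
    fp_letter u = fp_letter v -> nontrivial u -> nontrivial v -> u != v -> False.
  by move=> uv ntu ntv /eqP; apply; exact: (fp_letter_inj ntu ntv uv).
rewrite /Z3letters !big_cons big_nil setU0 !mU ?mu_letter //.
- by rewrite /step_prob /= -!EFinD; congr EFin; field.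
- by apply/seteqP; split => // g [-> /= H]; exact: ne H _ _ _.
- by apply/seteqP; split => // g [-> /= [H|H]]; exact: ne H _ _ _.
- by apply/seteqP; split => // g [-> /= [H|[H|H]]]; exact: ne H _ _ _.
Qed.

(* Keeping the event [B] of the increments from time [n] on in the statement  *)
(* lets the independence of [X n] and [x n] come out of the induction.        *)
Lemma expectation_future n (F : fp -> R) (J : {fset nat}) (A : nat -> set fp) :
  (forall g, 0 <= F g) -> (forall j, j \in J -> (n <= j)%N) ->
  let B := \bigcap_(j in [set` J]) (x j @^-1` A j) in
  (\int[P]_(w in B) (F (X n w))%:E = (iter n (avgmul p) F 1%g)%:E * P B)%E.
Proof.
elim: n F J A => [|n IHn] F J A F0 Jn B.
  rewrite /= -integral_cst //; apply: fin_bigcap_measurable => // j _; exact: step_meas.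
pose Bu u := B `&` x n @^-1` [set fp_letter u].
pose N := x n @^-1` [set g | ~ is_letter g].
have mB : measurable B by apply: fin_bigcap_measurable => // j _; exact: step_meas.
have mBu u : measurable (Bu u) by apply: measurableI => //; exact: step_meas.
have mN : measurable N by exact: step_meas.
have mF D k (G : fp -> R) : measurable_fun D ((fun w => (G (X k w))%:E) : T -> \bar R).
  by apply: measurable_funTS; exact: (measurable_fun_walk _ (fun g => (G g)%:E)).
rewrite (@ge0_negligible_integral _ _ _ P B N) //; last first.
- exact: not_letter_null.
- by move=> w _; rewrite lee_fin.
(* Off the null event [N], the event [B] splits according to the letter of step n. *)
have -> : B `\` N = \big[setU/set0]_(u <- Z3letters) Bu u.
  rewrite -bigcup_seq; apply/seteqP; split => w.
    move=> [Bw /contrapT[u ntu xu]]; exists u => /=; first by rewrite Z3lettersP.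
    by split.
  move=> [u /=]; rewrite Z3lettersP => ntu [Bw /= xu]; split => //.
  by apply; exists u.
rewrite ge0_integral_bigsetU //; first last.
- by move=> w _; rewrite lee_fin.
- exact: trivIset_letters.
have nJ : n \notin J by apply/negP => /Jn; rewrite ltnn.
(* Fixing step n adds the index n to the future event, which is exactly what the induction
   hypothesis at time n accepts. *)
have BuE u : Bu u = \bigcap_(j in [set` (n |` J)%fset])
    (x j @^-1` (if j == n then [set fp_letter u] else A j)).
  rewrite bigcap_fsetU1 eqxx setIC; congr (_ `&` _).
  apply: eq_bigcapr => j /= jJ; case: eqP => // jn.
  by move: nJ; rewrite -jn jJ.
have PBu u : nontrivial u -> P (Bu u) = ((step_prob u)%:E * P B)%E.
  move=> ntu.
  have [ind _] := hx.
  rewrite BuE ind // big_fsetU1 //= eqxx step_law mu_letter // /B ind //.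
  congr (_ * _)%E; apply: eq_big_seq => j jJ.
  by case: eqP => // jn; move: nJ; rewrite -jn jJ.
have IH u : nontrivial u ->
    (\int[P]_(w in Bu u) (F (X n.+1 w))%:E =
    (step_prob u * iter n (avgmul p) (fun g => F (g * fp_letter u)%g) 1%g)%:E * P B)%E.
  move=> ntu.
  have -> : (\int[P]_(w in Bu u) (F (X n.+1 w))%:E =
      \int[P]_(w in Bu u) (F (X n w * fp_letter u)%g)%:E)%E.
    by apply: eq_integral => w; rewrite inE => -[_ /= ->].
  rewrite BuE (IHn (fun g => F (g * fp_letter u)%g)) -?BuE ?PBu //; last first.
    by move=> j; rewrite in_fset1U => /orP[/eqP ->//|/Jn /ltnW].
  by rewrite EFinM muleCA muleA.
rewrite sum_letters !IH // iterSr /avgmul.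
have [b ->] : exists b, P B = b%:E.
  by exists (fine (P B)); rewrite fineK // fin_num_measure.
rewrite (iter_avgmul_avg p n (fun u g => F (g * fp_letter u)%g)) /avg /step_prob /=.
by rewrite -!EFinM -!EFinD; congr EFin; ring.
Qed.

Lemma expectation_walk n (F : fp -> R) : (forall g, 0 <= F g) ->
  (\int[P]_w (F (X n w))%:E = (iter n (avgmul p) F 1%g)%:E)%E.
Proof.
move=> F0.
have B0 : \bigcap_(j in [set` (fset0 : {fset nat})]) (x j @^-1` setT) = setT.
  by apply/seteqP; split => // w _ j.
have fs0 j : j \in (fset0 : {fset nat}) -> (n <= j)%N by [].
have := @expectation_future n F fset0 (fun=> setT) F0 fs0.
by rewrite /= B0 probability_setT mule1.
Qed.

Lemma ae_is_letter : {ae P, forall w n, is_letter (x n w)}.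
Proof.
apply: ae_foralln => n; exists (x n @^-1` [set g | ~ is_letter g]); split => //.
- exact: step_meas.
- exact: not_letter_null.
Qed.

Lemma ae_mart_cvg0 :
  {ae P, forall w, mart p n.+1 (X n.+1 w) / n.+1%:R @[n --> \oo] --> (0 : R)}.
Proof.
pose h n w := (mart p n.+1 (X n.+1 w) / n.+1%:R) ^+ 4.
pose c n : R := 4 * stepbound p ^+ 4 * n.+1%:R ^- 2.
have K4 : 0 <= stepbound p ^+ 4 by rewrite (exprD _ 2 2) mulr_ge0 ?sqr_ge0.
suff : {ae P, forall w, h n w @[n --> \oo] --> 0}.
  by apply: filterS => w; exact: cvg0_expr4.
apply: (@ae_cvg0_summable _ _ _ _ _ c (4 * stepbound p ^+ 4 * 2)).
- move=> n.
  exact: (measurable_fun_walk _ (fun g => (mart p n.+1 g / n.+1%:R) ^+ 4)).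
- by move=> n w; rewrite /h (exprD _ 2 2) mulr_ge0 ?sqr_ge0.
- move=> n.
  rewrite (@expectation_walk n.+1 (fun g => (mart p n.+1 g / n.+1%:R) ^+ 4)); last first.
    by move=> g; rewrite (exprD _ 2 2) mulr_ge0 ?sqr_ge0.
  (* An affine form with zero constant parts lets linearity extract the factor (n+1)^-4. *)
  rewrite lee_fin (_ : (fun g => _) =
      (fun g => (fun=> 0) g + n.+1%:R ^- 4 * mart p n.+1 g ^+ 4 + 0)).
    rewrite iter_avgmul_affine iter_avgmul_harmonic; last first.
      by move=> g; rewrite /avgmul /avg; ring.
    rewrite add0r addr0 /c.
    apply: le_trans (ler_wpM2l _ (mart4_bound hp n.+1)) _.
      by rewrite invr_ge0 exprn_ge0.
    have n0 : n.+1%:R != 0 :> R by rewrite pnatr_eq0.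
    by rewrite le_eqVlt; apply/orP; left; apply/eqP; field.
  by apply/funext => g; rewrite expr_div_n add0r addr0 mulrC.
- move=> N; rewrite /c -mulr_sumr; apply: ler_wpM2l;
    [exact: mulr_ge0 | exact: sum_inv_sqr_le].
Qed.

Lemma ae_drift : {ae P, forall w,
  (fplength (X n w))%:R / n%:R @[n --> \oo] --> speed p}.
Proof.
apply: filterS ae_mart_cvg0 => w mw.
rewrite -cvg_shiftS /=; apply: cvg_sub0 (cvg_cst (speed p)).
(* One error of [pot_size] comes from the current position and one from the starting point. *)
pose b : R := 2 * (1 + cpot p).
have hb n : `|(fplength (X n.+1 w))%:R / n.+1%:R - speed p| <=
    `|mart p n.+1 (X n.+1 w) / n.+1%:R| + b * harmonic n.
  have := pot_size hp (valP (X n.+1 w)); have := pot_size hp (isT : normal_form [::]).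
  rewrite /= subr0 -/(fplength _) => h0 h1.
  have n0 : 0 < n.+1%:R :> R by rewrite ltr0n.
  rewrite (_ : _ - speed p = mart p n.+1 (X n.+1 w) / n.+1%:R +
    (pot p [::] - (pot p (X n.+1 w) - (fplength (X n.+1 w))%:R)) * harmonic n).
    apply: le_trans (ler_normD _ _) _; rewrite lerD2l normrM.
    have hn : 0 <= harmonic n :> R by rewrite invr_ge0.
    rewrite (ger0_norm hn) ler_wpM2r //.
    apply: le_trans (ler_normB _ _) _; rewrite /b; lra.
  by rewrite /mart /harmonic /=; field; rewrite gt_eqF.
apply/norm_cvg0P.
apply: (squeeze_cvgr _ (f := fun=> 0)
  (h := fun n => `|mart p n.+1 (X n.+1 w) / n.+1%:R| + b * harmonic n)).
- by apply: nearW => n; rewrite normr_ge0 hb.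
- exact: cvg_cst.
- rewrite -[X in _ --> X](addr0 0) -{2}(mulr0 b); apply: cvgD.
    by apply/norm_cvg0P.
  exact: cvgMr cvg_harmonic.
Qed.

(** As [speed p] is positive, the length eventually exceeds n times half of it. *)
Lemma size_infty w :
  (fplength (X n w))%:R / n%:R @[n --> \oo] --> speed p ->
  forall k, \forall n \near \oo, (k <= fplength (X n w))%N.
Proof.
move=> dw k.
have g0 : 0 < speed p by case/andP: hp; rewrite /speed; nra.
have g2 : speed p / 2 < speed p by lra.
have near1 := cvgr_gt (speed p) dw (speed p / 2) g2.
near=> n.
have n0 : 0 < n%:R :> R by rewrite ltr0n; near: n; exact: nbhs_infty_gt.
have : speed p / 2 < (fplength (X n w))%:R / n%:R by near: n; exact: near1.
rewrite ltr_pdivlMr // => h.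
rewrite -(ler_nat R); apply: ltW; apply: le_lt_trans h.
rewrite mulrC -ler_pdivrMr ?divr_gt0 //; near: n; exact: nbhs_infty_ger.
Unshelve. all: by end_near. Qed.

Lemma walk_letterwise_cvg w : (forall n, is_letter (x n w)) ->
  (fplength (X n w))%:R / n%:R @[n --> \oo] --> speed p ->
  letterwise_cvg (X ^~ w) (letter_limit (X ^~ w)).
Proof.
move=> xw dw; apply: letter_limit_cvg; last exact: size_infty.
by move=> n; have [u ntu e] := xw n; exists u => //=; rewrite e.
Qed.

Lemma exists_harmonic_measure :
  exists nu : probability (infword 'Z_3 'Z_3) R, is_harmonic_measure P x nu.
Proof.
have mf : measurable_fun setT (fun w => letter_limit (X ^~ w)).
  by apply: measurable_letter_limit => n A; exact: measurable_walk.
pose Y : {mfun T >-> infword 'Z_3 'Z_3} := mfun_Sub (mem_set mf).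
exists (distribution P Y), Y; split => //.
- apply: filterS2 ae_is_letter ae_drift => w xw dw.
  exact: letterwise_cvg_nf (walk_letterwise_cvg xw dw).
- apply: filterS2 ae_is_letter ae_drift => w xw dw.
  exact: walk_letterwise_cvg.
Qed.

Lemma cylprob_cvg (t : seq Z3letter) (g : nat -> fp) (xi : infword 'Z_3 'Z_3) :
  letterwise_cvg g xi ->
  cylprob p t (fpword (g n)) @[n --> \oo] --> (\1_(@cylinder 'Z_3 'Z_3 t) xi : R).
Proof.
move=> gxi; apply/cvgrPdist_le => e e0.
have r1 : `|rhomax p| < 1 by rewrite ger0_norm ?rhomax_lt1 // ltW // rhomax_gt0.
(* The index m makes [2 * rhomax p ^+ m] smaller than e; it then suffices that the word exceeds [t]
   by m letters. *)
have /cvgr0Pnorm_lt/(_ (e / 2)) := cvg_expr r1.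
rewrite divr_gt0 // => /(_ isT)[m _ Hm].
have tk := letterwise_cvg_take (size t) gxi.
have sz := letterwise_cvg_size (size t + m) gxi.
near=> n.
have -> : \1_(@cylinder 'Z_3 'Z_3 t) xi = (prefix t (fpword (g n)))%:R :> R.
  rewrite prefixE (near tk n) // indicE.
  suff -> : (xi \in @cylinder 'Z_3 'Z_3 t) = (mkseq xi (size t) == t) by [].
  by apply/idP/eqP => [/set_mem|] h; [exact: h|apply/mem_set; exact: h].
rewrite distrC; apply: le_trans (cylprob_approx hp t (fpword (g n))) _.
have := Hm (size (fpword (g n)) - size t)%N; rewrite /= leq_subRL; last first.
  by apply: leq_trans (near sz n _) => //; exact: leq_addr.
move=> /(_ (near sz n _)).
rewrite ger0_norm ?exprn_ge0 ?(ltW (rhomax_gt0 hp)) // => h.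
by rewrite mulrC -ler_pdivlMr // ltW // h.
Unshelve. all: by end_near. Qed.

Lemma harmonic_measure_cylinder (nu : probability (infword 'Z_3 'Z_3) R) t :
  normal_form t -> is_harmonic_measure P x nu ->
  nu (@cylinder 'Z_3 'Z_3 t) = (cylw p t)%:E.
Proof.
move=> nft [Y [_ Ycvg Ylaw]].
have mC := @measurable_cylinder 'Z_3 'Z_3 t.
rewrite -Ylaw // /distribution /pushforward.
have mYC : measurable (Y @^-1` (@cylinder 'Z_3 'Z_3 t)).
  by rewrite -[_ @^-1` _]setTI; apply: (measurable_funPT Y).
pose f_ n w := (cylprob p t (fpword (X n w)))%:E.
pose f w : \bar R := (\1_(Y @^-1` (@cylinder 'Z_3 'Z_3 t)) w)%:E.
have [] := @dominated_convergence _ _ _ P setT measurableT f_ f (cst 1%E).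
- by move=> n; exact: (measurable_fun_walk _ (fun g => (cylprob p t (fpword g))%:E)).
- by apply/measurable_EFinP; exact: measurable_indic.
- apply: filterS Ycvg => w cw _; apply: cvg_EFin; first exact: nearW.
  exact: (cylprob_cvg (t := t) cw).
- exact: finite_measure_integrable_cst.
- apply: aeW => w n _; have /andP[c0 c1] := cylprob_bounds hp t (fpword (X n w)).
  by rewrite /f_ abse_EFin lee_fin ger0_norm.
move=> _ _; rewrite integral_indic // setIT => cvgI.
(* By harmonicity these integrals are constant, equal to the value at the identity. *)
have I n : (\int[P]_w f_ n w = (cylw p t)%:E)%E.
  rewrite /f_ (@expectation_walk n (fun g => cylprob p t (fpword g))); last first.
    by move=> g; case/andP: (cylprob_bounds hp t (fpword g)).
  rewrite iter_avgmul_harmonic ?cylprob_nil // => g.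
  by rewrite avgmul_word; exact: (cylprob_harm hp nft (valP g)).
have cvgC : [sequence (\int[P]_(w in setT) f_ n w)%E]_n @ \oo --> (cylw p t)%:E.
  by rewrite (_ : [sequence _]_n = fun=> (cylw p t)%:E);
    [exact: cvg_cst|apply/funext => n; exact: I].
exact: (cvg_unique (@ereal_hausdorff R) cvgI cvgC).
Qed.

Lemma harmonic_measure_inf_normal_form (nu : probability (infword 'Z_3 'Z_3) R) :
  is_harmonic_measure P x nu -> nu (@inf_normal_form 'Z_3 'Z_3) = 1%E.
Proof.
move=> [Y [Ynf _ Ylaw]].
have mN := @measurable_inf_normal_form 'Z_3 'Z_3.
rewrite -Ylaw // /distribution /pushforward.
set A := Y @^-1` _.
have mA : measurable A.
  by rewrite -[A]setTI; apply: (measurable_funPT Y).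
have : P (~` A) = 0%E by apply/(negligibleP P); [exact: measurableC|exact: Ynf].
rewrite probability_setC // => /eqP; rewrite sube_eq ?fin_num_measure //.
by rewrite add0e => /eqP.
Qed.

End Walk.

(** * Arbitrary generators and the final assembly *)

Lemma generator_Z3 (c : 'Z_3) : generator [set: 'Z_3]%SET c -> c != 1%g.
Proof.
rewrite /generator => /eqP E; apply/eqP => c1.
by have := congr1 (fun A : {set 'Z_3} => ga \in A) E; rewrite /= inE c1 cycle1 inE.
Qed.

(** Either choice of generator lists, with its square, both nontrivial elements. Data given on a,
    a^2, b, b^2 thus extend to all nontrivial letters. *)
Lemma Z3_generator_ind (c : 'Z_3) (Q : 'Z_3 -> Prop) :
  generator [set: 'Z_3]%SET c -> Q c -> Q (c ^+ 2)%g ->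
  forall y, y != 1%g -> Q y.
Proof.
move=> /generator_Z3/Z3_nontrivial cE Qc Qc2 y /Z3_nontrivial yE.
have e1 : (ga ^+ 2)%g = gb by [].
have e2 : (gb ^+ 2)%g = ga by apply: val_inj.
by case: cE Qc Qc2 yE => -> ; rewrite ?e1 ?e2 => ? ? [] ->.
Qed.

Lemma sum_Sigma (V : nmodType) (Q : pred Z3letter) (F : Z3letter -> V) :
  \sum_(u in Sigma 'Z_3 'Z_3 | Q u) F u = \sum_(u <- Z3letters | Q u) F u.
Proof.
rewrite [LHS]big_mkcondr [RHS]big_mkcond big_uniq //; apply: eq_bigl => u.
by rewrite inE Z3lettersP.
Qed.

Theorem mainTheorem5 (R : realType) (p : R) (hp : 0 < p < 1 / 2)
    (a b : 'Z_3)
    (ha : generator [set: 'Z_3]%SET a) (hb : generator [set: 'Z_3]%SET b)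
    (mu : probability (freeprod 'Z_3 'Z_3) R)
    (mu_a : mu [set fp_letter (inl a)] = p%:E)
    (mu_a2 : mu [set fp_letter (inl (a ^+ 2)%g)] = p%:E)
    (mu_b : mu [set fp_letter (inr b)] = (1 / 2 - p)%:E)
    (mu_b2 : mu [set fp_letter (inr (b ^+ 2)%g)] = (1 / 2 - p)%:E)
    (r : letter 'Z_3 'Z_3 -> R)
    (r_a : r (inl a) = (1 + 2 * p) / 6)
    (r_a2 : r (inl (a ^+ 2)%g) = (1 + 2 * p) / 6)
    (r_b : r (inr b) = (1 - p) / 3)
    (r_b2 : r (inr (b ^+ 2)%g) = (1 - p) / 3)
    (d : measure_display) (T : measurableType d) (P : probability T R)
    (x : nat -> {mfun T >-> freeprod 'Z_3 'Z_3})
    (hx : iid P mu x) :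
  [/\ exists nu : probability (infword 'Z_3 'Z_3) R, is_harmonic_measure P x nu,
      forall nu : probability (infword 'Z_3 'Z_3) R,
        is_harmonic_measure P x nu -> is_markovian_multiplicative r nu &
      is_drift P x (2 * p * (1 - 2 * p))].
Proof.
have [p0 p1] := andP hp.
have mu_letter u : nontrivial u -> mu [set fp_letter u] = (step_prob p u)%:E.
  case: u => y /=.
    exact: (Z3_generator_ind (Q := fun y => mu [set fp_letter (inl y)] = p%:E) ha).
  exact: (Z3_generator_ind
    (Q := fun y => mu [set fp_letter (inr y)] = (1 / 2 - p)%:E) hb).
have rE u : nontrivial u -> r u = rvec p u.
  case: u => y /=.
    exact: (Z3_generator_ind (Q := fun y => r (inl y) = (1 + 2 * p) / 6) ha).
  exact: (Z3_generator_ind (Q := fun y => r (inr y) = (1 - p) / 3) hb).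
split.
- exact: (exists_harmonic_measure hp mu_letter hx).
- move=> nu hnu; split.
  + move=> u; rewrite inE => ntu; rewrite rE //.
    by have /andP[-> h] := rvec_bounds hp u; apply: lt_trans h _; lra.
  + have := @sum_Sigma R predT r; under eq_bigl do rewrite andbT.
    by move=> ->; rewrite /Z3letters !big_cons big_nil !rE // /rvec /=; field.
  + exact: (harmonic_measure_inf_normal_form hnu).
  + move=> s u nsu; rewrite (harmonic_measure_cylinder hp mu_letter hx nsu hnu).
    congr EFin.
    elim: s nsu => [|v s IHs]; rewrite /= normal_form_cons.
      by move=> /andP[ntu _]; rewrite big_nil mul1r rE.
    move=> /and3P[ntv nsu _].
    rewrite -/(cylw p (v :: rcons s u)) cylw_rho; last by case: (s).
    rewrite IHs // big_cons mulrA; congr (_ * _ * _).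
    (* It remains to see q(v) = [rho p v]: the other factor has total weight twice its common value
       of r. *)
    rewrite /qweight rE //.
    have -> : \sum_(w in Sigma 'Z_3 'Z_3 :\: Sigma_of v) r w =
        \sum_(w in Sigma 'Z_3 'Z_3 | ~~ same_factor v w) r w.
      by apply: eq_bigl => w; rewrite !inE; case: (nontrivial w); rewrite ?andbT ?andbF.
    rewrite sum_Sigma /Z3letters !big_cons big_nil.
    by case: v ntv nsu => y _ _; rewrite /= !rE // /rvec /rho /=; field;
      rewrite !gt_eqF //; lra.
- exact: (ae_drift hp mu_letter hx).
Qed.
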